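(* Let $g:\mathbb{R}^m\to\mathbb{R}$ be a (not necessarily convex) Fréchet differentiable function whose gradient is $L_g$-Lipschitz continuous ($L_g\ge 0$), and assume $g$ is bounded from below. Let $\alpha>0$, $\beta\in(0,1)$, $0<s<\frac{2(1-\beta)}{L_g}$, and let $(x_n)_{n\in\mathbb{N}}$, $(y_n)_{n\in\mathbb{N}}$ be the sequences generated from a starting point $x_0=y_0\in\mathbb{R}^m$ by $$x_{n+1}=y_n-s\nabla g(y_n)\ (n\ge 0),\qquad y_n=x_n+\frac{\beta n}{n+\alpha}(x_n-x_{n-1})\ (n\ge 1).$$ Assume that $(x_n)_{n\in\mathbb{N}}$ is bounded, let $\overline{x}\in\operatorname{crit}(g)$ be such that $\lim_{n\to+\infty}x_n=\overline{x}$, and suppose that $g$ fulfills the Łojasiewicz property at $\overline{x}$ with Łojasiewicz exponent $\theta\in\left(\frac12,1\right)$. Then there exist $b_1,b_2,b_3,b_4>0$ and $\overline{N}_1\in\mathbb{N}$ such that: (b$_1$) $g(y_n)-g(\overline{x})\le b_1\frac{1}{n^{\frac{1}{2\theta-1}}}$ for all $n\ge\overline{N}_1+2$; (b$_2$) $g(x_n)-g(\overline{x})\le b_2\frac{1}{n^{\frac{1}{2\theta-1}}}$ for all $n\ge\overline{N}_1+2$; (b$_3$) $\|x_n-\overline{x}\|\le b_3\frac{1}{n^{\frac{1-\theta}{2\theta-1}}}$ for all $n\ge\overline{N}_1+2$; (b$_4$) $\|y_n-\overline{x}\|\le b_4\frac{1}{n^{\frac{1-\theta}{2\theta-1}}}$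 for all $n>\overline{N}_1+2$.
   Context: $\|\cdot\|$ is the Euclidean norm; $\mathbb{N}=\{0,1,2,\dots\}$; $\operatorname{crit} f=\{x:\nabla f(x)=0\}$ for a differentiable function $f$. ''$L_g$-Lipschitz continuous gradient'' means $\|\nabla g(x)-\nabla g(y)\|\le L_g\|x-y\|$ for all $x,y$. The condition $0<s<\frac{2(1-\beta)}{L_g}$ is read as $s>0$ and $sL_g<2(1-\beta)$ (so when $L_g=0$ any $s>0$ is allowed). Łojasiewicz property: a differentiable function $f:\mathbb{R}^k\to\mathbb{R}$ fulfills the Łojasiewicz property at $\overline{z}\in\operatorname{crit} f$ with Łojasiewicz exponent $\theta\in(0,1)$ if there exist $K,\epsilon>0$ such that $|f(z)-f(\overline{z})|^\theta\le K\|\nabla f(z)\|$ for every $z$ with $\|z-\overline{z}\|<\epsilon$. *)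

(* Defs.v *)
From mathcomp Require Import all_boot all_order all_algebra.
From mathcomp Require Import all_classical all_reals all_analysis.

Set Implicit Arguments.
Unset Strict Implicit.
Unset Printing Implicit Defensive.

Import Order.TTheory GRing.Theory Num.Theory.
Import numFieldNormedType.Exports.

Local Open Scope classical_set_scope.
Local Open Scope ring_scope.

(* R^m is 'rV[R]_m. The norm `|x| carried by the library on matrices is the
   max norm, so the Euclidean one is defined here. Limits and Frechet
   differentiability are the library's; they do not depend on which of the two
   norms is used, by [enorm_ge_norm] and [enorm_le_norm]. *)
Definition dotr (R : realType) (m : nat) (u v : 'rV[R]_m) : R :=
  \sum_(i < m) u 0 i * v 0 i.

Definition enorm (R : realType) (m : nat) (u : 'rV[R]_m) : R :=
  Num.sqrt (dotr u u).

(* Only meaningful where f is differentiable, since 'd f x is otherwise an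
   unspecified linear map. *)
Definition gradient (R : realType) (m : nat) (f : 'rV[R]_m -> R)
    (x : 'rV[R]_m) : 'rV[R]_m :=
  \row_(i < m) 'd f x (delta_mx 0 i).

Definition crit (R : realType) (m : nat) (f : 'rV[R]_m -> R) :
    set 'rV[R]_m :=
  [set x | gradient f x = 0].

(* To be used for f differentiable, zbar in crit f and 0 < theta < 1. *)
Definition lojasiewicz_at (R : realType) (m : nat) (f : 'rV[R]_m -> R)
    (zbar : 'rV[R]_m) (theta : R) : Prop :=
  exists K eps : R, [/\ 0 < K, 0 < eps &
    forall z : 'rV[R]_m, enorm (z - zbar) < eps ->
      `|f z - f zbar| `^ theta <= K * enorm (gradient f z)].

Lemma diff_gradient (R : realType) (m : nat) (f : 'rV[R]_m -> R)
    (x v : 'rV[R]_m) :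
  'd f x v = dotr (gradient f x) v.
Proof.
rewrite [in LHS](row_sum_delta v) linear_sum; apply: eq_bigr => i _.
by rewrite linearZ mxE mulrC.
Qed.

Lemma enorm_ge_norm (R : realType) (m : nat) (x : 'rV[R]_m) :
  `|x| <= enorm x.
Proof.
rewrite [leLHS]/Num.norm/=.
have [->|/mx_norm_neq0[[i j] ->]] := eqVneq (mx_norm x) 0.
  exact: sqrtr_ge0.
rewrite /= ord1 -sqrtr_sqr ler_wsqrtr// /dotr (bigD1 j)//= -expr2 lerDl.
by apply: sumr_ge0 => k _; rewrite -expr2 sqr_ge0.
Qed.

Lemma enorm_le_norm (R : realType) (m : nat) (x : 'rV[R]_m) :
  enorm x <= Num.sqrt m%:R * `|x|.
Proof.
rewrite -[`|x|]ger0_norm// -sqrtr_sqr -sqrtrM ?ler0n// ler_wsqrtr//.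
rewrite mulr_natl -[X in _ *+ X]card_ord -sumr_const; apply: ler_sum => i _.
rewrite -expr2 -real_normK ?num_real// ler_sqr ?nnegrE//.
rewrite [leRHS]/Num.norm/= mx_normE num_le.
exact: (le_bigmax _ (fun j => `|x j.1 j.2|%:nng) (0, i)).
Qed.

(* Main.v *)
Require Import Defs.
From mathcomp Require Import all_boot all_order all_algebra.
From mathcomp Require Import all_classical all_reals all_analysis.
From mathcomp Require Import ring lra.

(** Put a = x_(n+1) - x_n, w = y_(n+1) - y_n and q = beta_(n+1). Since
    s grad g(y_n) = q a - w and y_n - x_n = (1 + q) a - w, the descent lemma
    applied from y_n to y_(n+1) shows that the energy
    E_n = g(y_n) + |y_n - x_n|^2 / (2 s) drops by at least
    ((1/2 + q) |a - w|^2 + (1 - s L_g / 2 - q) |w|^2) / s, hence by at least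
    c D_n^2 with D_n = |a - w| + |w|. As |y_n - x_n| and s |grad g(y_n)| are at
    most 2 D_n, the Lojasiewicz inequality gives e_n^theta <= C D_n for
    e_n = E_n - g(xbar), so that e_n^(2 theta) <= M (e_n - e_(n+1)). The tangent
    inequality for t |-> t^(1 - 2 theta) turns this into the rate of e_n, and
    the one for t |-> t^(1 - theta) bounds D_n by a telescoping difference
    of A e_n^(1 - theta), which controls the distances to xbar. *)

Set Implicit Arguments.
Unset Strict Implicit.
Unset Printing Implicit Defensive.

Import Order.TTheory GRing.Theory Num.Theory.
Import numFieldNormedType.Exports.

Local Open Scope classical_set_scope.
Local Open Scope ring_scope.

(** * Inequalities for real powers *)

(** Convexity of the power, obtained without derivatives: b^(-t) is a^(-t) times the exponential of
    - t ln (b / a), and the bounds 1 + z <= exp z and ln (b / a) <= b / a - 1 finish. *)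
Lemma powRN_tangent (R : realType) (a b t : R) : 0 < a -> 0 < b -> 0 <= t ->
  a `^ (- t) + t * (a - b) * a `^ (- t - 1) <= b `^ (- t).
Proof.
move=> a0 b0 t0.
have -> : a `^ (- t - 1) = a `^ (- t) / a.
  by rewrite powRB ?(gt_eqF a0) ?implybT// powRr1// ltW.
have -> : b `^ (- t) = a `^ (- t) * expR (- t * ln (b / a)).
  rewrite lnM ?posrE ?invr_gt0// lnV ?posrE// /powR !gt_eqF// -expRD.
  by congr expR; ring.
have ab : t * ln (b / a) <= t * (b / a - 1).
  rewrite ler_wpM2l// -[in leLHS](subrKC 1 (b / a)) le_ln1Dx//.
  by rewrite ltrBrDl subrr divr_gt0.
rewrite -[X in X + _]mulr1 mulrCA -mulrDr ler_pM2l ?powR_gt0//.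
apply: le_trans (expR_ge1Dx _); rewrite lerD2l mulNr.
suff <- : - (t * (b / a - 1)) = t * (a - b) / a by rewrite lerN2.
by field; rewrite gt_eqF.
Qed.

(* The optimal constant is [p]; [p / 2] already follows from [powRN_tangent]. *)
Lemma powR_sub_ge (R : realType) (a b p : R) :
  0 < a -> 0 <= b <= a -> 0 < p <= 1 ->
  p / 2 * (a - b) * a `^ (p - 1) <= a `^ p - b `^ p.
Proof.
move=> a0 /andP[b0 ba] /andP[p0 p1].
have ap0 : 0 < a `^ p by rewrite powR_gt0.
have -> : a `^ (p - 1) = a `^ p / a.
  by rewrite powRB ?(gt_eqF a0) ?implybT// powRr1// ltW.
have [->|bN0] := eqVneq b 0.
  rewrite powR0 ?gt_eqF// !subr0.
  suff -> : p / 2 * a * (a `^ p / a) = p / 2 * a `^ p by nra.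
  by field; rewrite gt_eqF.
have {}b0 : 0 < b by rewrite lt_neqAle eq_sym bN0.
have bp0 : 0 < b `^ p by rewrite powR_gt0.
have := powRN_tangent a0 b0 (ltW p0).
rewrite powRB ?(gt_eqF a0) ?implybT// powRr1 ?(ltW a0)// !powRN.
set X := a `^ p in ap0 *; set Y := b `^ p in bp0 *.
set d := p * (a - b) / a.
have -> : X^-1 + p * (a - b) * (X^-1 / a) = (1 + d) / X.
  by rewrite /d; field; rewrite !gt_eqF.
rewrite ler_pdivrMr// mulrC ler_pdivlMr// => H.
have -> : p / 2 * (a - b) * (X / a) = d / 2 * X.
  by rewrite /d; field; rewrite gt_eqF.
have d0 : 0 <= d by rewrite /d !mulr_ge0 ?subr_ge0 ?invr_ge0// ltW.
have d1 : d <= 1.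
  by rewrite /d ler_pdivrMr// mul1r; nra.
(* Here (1 + d) Y <= X. If X <= 2 Y, then d X / 2 <= d Y <= X - Y; otherwise X - Y exceeds X / 2,
   which is at least d X / 2 since d <= 1. *)
by have [|] := lerP X (2 * Y); nra.
Qed.

(** * Recursions of Lojasiewicz type *)

(** By [powR_sub_ge] with p = 1 - theta, the difference of powers is at least (1 - theta) / 2 times
    (e - e') / e^theta. The numerator is at least c D^2 and the denominator at most C D, so one
    factor D cancels. *)
Lemma loj_increment (R : realType) (c C theta e e' D : R) :
    0 < theta < 1 -> 0 < c -> 0 < C -> 0 <= e -> 0 <= e' -> 0 <= D ->
    c * D ^+ 2 <= e - e' -> e `^ theta <= C * D ->
  D <= 2 * C / ((1 - theta) * c) * (e `^ (1 - theta) - e' `^ (1 - theta)).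
Proof.
move=> /andP[t0 t1] c0 C0 e0 e'0 D0 cD eCD.
have ee' : e' <= e.
  by rewrite -subr_ge0 (le_trans _ cD)// mulr_ge0 ?sqr_ge0// ltW.
have [eE|eN0] := eqVneq e 0.
  have e'E : e' = 0 by apply/eqP; rewrite eq_le e'0 -eE ee'.
  move: cD; rewrite eE e'E !subrr mulr0 pmulr_rle0// => D2.
  by rewrite -[D]ger0_norm// -sqrtr_sqr (ler0_sqrtr D2).
have {eN0}e0 : 0 < e by rewrite lt_neqAle eq_sym eN0.
have et0 : 0 < e `^ theta by rewrite powR_gt0.
have t1' : 0 < 1 - theta <= 1 by apply/andP; split; lra.
have := powR_sub_ge e0 (introT andP (conj e'0 ee')) t1'.
rewrite addrAC subrr add0r powRN.
set P := _ `^ theta in et0 eCD *; set d := _ - _ `^ _ => H.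
have H' : (1 - theta) / 2 * (c * D ^+ 2) <= P * d.
  rewrite [P * d]mulrC -ler_pdivrMr//; apply: le_trans H.
  by rewrite ler_wpM2r ?invr_ge0 ?(ltW et0)// ler_wpM2l//; lra.
have Dp : 0 < D by rewrite -(pmulr_rgt0 _ C0) (lt_le_trans et0).
have d0 : 0 <= d.
  rewrite -(pmulr_rge0 _ et0) (le_trans _ H')// mulr_ge0//; first lra.
  by rewrite mulr_ge0 ?sqr_ge0// ltW.
have tc : 0 < (1 - theta) * c by rewrite mulr_gt0//; lra.
rewrite mulrAC ler_pdivlMr// -(ler_pM2r Dp).
have : P * d <= C * D * d by rewrite ler_wpM2r.
nra.
Qed.

(** With tau = 2 theta - 1, the tangent inequality gives e_(n+1)^(- tau) - e_n^(- tau) >= tau (e_n -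
    e_(n+1)) e_n^(- 2 theta) >= tau / M. Thus e_n^(- tau) grows at least linearly, and inverting the
    power gives the rate. *)
Lemma loj_rate (R : realType) (e : nat -> R) (M theta : R) (N : nat) :
    2^-1 < theta -> 0 < M ->
    (forall n, (N <= n)%N -> 0 <= e n) ->
    (forall n, (N <= n)%N -> e n `^ (2 * theta) <= M * (e n - e n.+1)) ->
  exists2 b : R, 0 < b &
    forall n, (N < n)%N -> e n <= b * n%:R `^ (- (1 / (2 * theta - 1))).
Proof.
move=> theta_gt M0 e0 eM; set tau := 2 * theta - 1.
have tau0 : 0 < tau by rewrite /tau; lra.
have edec n : (N <= n)%N -> e n.+1 <= e n.
  move=> Nn; rewrite -subr_ge0 -(pmulr_rge0 _ M0).
  by apply: le_trans (eM _ Nn); exact: powR_ge0.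
(* Positivity matters: [powR] sends 0 to 0 for a nonzero exponent, so the growth would fail once e
   vanishes. As e is nonincreasing, positivity at N + k passes to the earlier indices. *)
have key k : 0 < e (N + k)%N -> k%:R * (tau / M) <= e (N + k)%N `^ (- tau).
  elim: k => [|k IH]; first by rewrite mul0r powR_ge0.
  rewrite addnS => ek1.
  have ek : 0 < e (N + k)%N.
    by apply: lt_le_trans ek1 (edec _ _); exact: leq_addr.
  apply: le_trans (powRN_tangent ek ek1 (ltW tau0)).
  rewrite -natr1 mulrDl mul1r lerD ?IH//.
  rewrite ler_pdivrMr// -[leLHS]mulr1 -!mulrA ler_pM2l//.
  have := eM _ (leq_addr k N).
  rewrite -(@ler_pM2r _ (e (N + k)%N `^ (- tau - 1))) ?powR_gt0//.
  rewrite -powRD ?(gt_eqF ek) ?implybT//.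
  have -> : 2 * theta + (- tau - 1) = 0 by rewrite /tau; ring.
  by rewrite powRr0; lra.
have itau : 0 < 1 / tau by rewrite divr_gt0.
(* The divisor N + 1 replaces n - N by n, since n <= (N + 1) (n - N) for n > N. *)
pose K := tau / M / N.+1%:R.
have K0 : 0 < K by rewrite !divr_gt0.
exists (K `^ (- (1 / tau))); first by rewrite powR_gt0.
move=> n Nn; have := e0 n (ltnW Nn); rewrite le_eqVlt => /predU1P[<-|en].
  by rewrite mulr_ge0 ?powR_ge0.
have n0 : 0 < n%:R :> R by rewrite ltr0n (leq_ltn_trans _ Nn).
have Kn : K * n%:R <= e n `^ (- tau).
  have := key (n - N)%N; rewrite subnKC ?(ltnW Nn)// => /(_ en).
  apply: le_trans; rewrite /K -mulrA mulrC ler_pM2r ?divr_gt0//.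
  rewrite mulrC ler_pdivrMr// -natrM ler_nat mulnS.
  by rewrite -[leqLHS](subnK (ltnW Nn)) leq_add2l leq_pmull ?subn_gt0.
have -> : e n = (e n `^ (- tau)) `^ (- (1 / tau)).
  rewrite -powRrM; have -> : - tau * - (1 / tau) = 1 by field; rewrite gt_eqF.
  by rewrite powRr1 ?ltW.
rewrite -powRM ?(ltW K0) ?(ltW n0)// [leLHS]powRN [leRHS]powRN.
by rewrite lef_pV2 ?posrE ?powR_gt0 ?(mulr_gt0 K0 n0)// ge0_ler_powR
  ?nnegrE ?powR_ge0 ?(ltW itau) ?(ltW (mulr_gt0 K0 n0)).
Qed.

Lemma is_derive_subquadratic (R : realType) (f : R -> R) (df a b t : R) :
  is_derive t (1 : R) f df ->
  is_derive t (1 : R) (fun t => f t - t * a - t ^+ 2 * b) (df - a - 2 * t * b).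
Proof.
move=> fdf.
have -> : (fun t => f t - t * a - t ^+ 2 * b) = f - a \*: id - b \*: (id ^+ 2).
  by apply/funext => r; rewrite !fctE /= /GRing.scale/=; ring.
by apply: is_derive_eq; rewrite /GRing.scale/=; ring.
Qed.

(** * Euclidean inner product and norm *)

Section EuclideanNorm.
Variables (R : realType) (m : nat).
Implicit Types (u v w : 'rV[R]_m) (a : R).

Lemma dotrC u v : dotr u v = dotr v u.
Proof. by apply: eq_bigr => i _; rewrite mulrC. Qed.

Lemma dotrDl u v w : dotr (u + v) w = dotr u w + dotr v w.
Proof. by rewrite -big_split; apply: eq_bigr => i _; rewrite mxE mulrDl. Qed.

Lemma dotrZl a u v : dotr (a *: u) v = a * dotr u v.
Proof. by rewrite mulr_sumr; apply: eq_bigr => i _; rewrite mxE mulrA. Qed.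

Lemma dotrDr u v w : dotr u (v + w) = dotr u v + dotr u w.
Proof. by rewrite dotrC dotrDl !(dotrC u). Qed.

Lemma dotrZr a u v : dotr u (a *: v) = a * dotr u v.
Proof. by rewrite dotrC dotrZl dotrC. Qed.

Lemma dotrNl u v : dotr (- u) v = - dotr u v.
Proof. by rewrite -scaleN1r dotrZl mulN1r. Qed.

Lemma dotrNr u v : dotr u (- v) = - dotr u v.
Proof. by rewrite dotrC dotrNl dotrC. Qed.

Definition dotrE := (dotrDl, dotrDr, dotrNl, dotrNr, dotrZl, dotrZr).

Lemma dotr_ge0 u : 0 <= dotr u u.
Proof. by apply: sumr_ge0 => i _; rewrite -expr2 sqr_ge0. Qed.

Lemma enorm_ge0 u : 0 <= enorm u.
Proof. exact: sqrtr_ge0. Qed.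

Lemma enorm_sqr u : enorm u ^+ 2 = dotr u u.
Proof. by rewrite sqr_sqrtr ?dotr_ge0. Qed.

Lemma enormZ a u : enorm (a *: u) = `|a| * enorm u.
Proof.
by rewrite /enorm dotrZl dotrZr mulrA -expr2 sqrtrM ?sqr_ge0// sqrtr_sqr.
Qed.

Lemma enormN u : enorm (- u) = enorm u.
Proof. by rewrite -scaleN1r enormZ normrN1 mul1r. Qed.

Lemma enorm_eq0 u : enorm u = 0 -> u = 0.
Proof.
move=> u0; apply/normr0_eq0/eqP; rewrite eq_le normr_ge0 andbT -u0.
exact: enorm_ge_norm.
Qed.

(** Cauchy-Schwarz: expand the square of | |v| u - |u| v | and divide by 2 |u| |v|, the zero vectors
    being treated apart. *)
Lemma dotr_le_enorm u v : dotr u v <= enorm u * enorm v.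
Proof.
have [/enorm_eq0->|uN0] := eqVneq (enorm u) 0.
  by rewrite -(scale0r 0) dotrZl enormZ normr0 !mul0r.
have [/enorm_eq0->|vN0] := eqVneq (enorm v) 0.
  by rewrite -(scale0r 0) dotrZr enormZ normr0 !(mul0r, mulr0).
have u0 : 0 < enorm u by rewrite lt_neqAle eq_sym uN0 enorm_ge0.
have v0 : 0 < enorm v by rewrite lt_neqAle eq_sym vN0 enorm_ge0.
have := dotr_ge0 (enorm v *: u - enorm u *: v).
rewrite !dotrE -!enorm_sqr (dotrC v u) => H.
rewrite -(ler_pM2l (mulr_gt0 u0 v0)).
by move: H; set a := enorm u; set b := enorm v; set d := dotr u v; nra.
Qed.

Lemma ler_enormD u v : enorm (u + v) <= enorm u + enorm v.
Proof.
rewrite -ler_sqr ?nnegrE ?addr_ge0 ?enorm_ge0//.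
rewrite enorm_sqr !dotrE (dotrC v u) -!enorm_sqr.
have := dotr_le_enorm u v; nra.
Qed.

Lemma enorm_cvg0 (z : nat -> 'rV[R]_m) :
  z n @[n --> \oo] --> (0 : 'rV[R]_m) -> enorm (z n) @[n --> \oo] --> (0 : R).
Proof.
move=> z0; apply: (@squeeze_cvgr _ _ _ _ (cst 0)
  (fun n => Num.sqrt m%:R * `|z n|)).
- by near=> n; rewrite enorm_ge0 enorm_le_norm.
- exact: cvg_cst.
- rewrite -(mulr0 (Num.sqrt m%:R)); apply: cvgM; first exact: cvg_cst.
  by rewrite -(@normr0 _ 'rV[R]_m); exact: cvg_norm.
Unshelve. all: by end_near. Qed.

(** The steps telescope: z n and z (n + k) are within h n - h (n + k) <= h n of each other, and k
    tends to infinity. This turns a decay rate of the energy into one for the iterates. *)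
Lemma enorm_lim_le (z : nat -> 'rV[R]_m) (zbar : 'rV[R]_m) (h : nat -> R)
    (N : nat) :
    z n @[n --> \oo] --> zbar ->
    (forall n, (N <= n)%N -> 0 <= h n) ->
    (forall n, (N <= n)%N -> enorm (z n.+1 - z n) <= h n - h n.+1) ->
  forall n, (N <= n)%N -> enorm (z n - zbar) <= h n.
Proof.
move=> zcvg h0 zh n Nn.
have tele k : enorm (z n - z (n + k)%N) <= h n - h (n + k)%N.
  elim: k => [|k IH].
    by rewrite addn0 !subrr /enorm -(scale0r 0) dotrZl mul0r sqrtr0.
  rewrite addnS.
  have -> : z n - z (n + k).+1 =
      (z n - z (n + k)%N) + - (z (n + k).+1 - z (n + k)%N).
    by rewrite opprB addrA subrK.
  apply: le_trans (ler_enormD _ _) _; rewrite enormN.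
  by have := zh _ (leq_trans Nn (leq_addr k n)); lra.
have dist0 : enorm (z k - zbar) @[k --> \oo] --> (0 : R).
  by apply: enorm_cvg0; rewrite -(subrr zbar); apply: cvgB => //;
    exact: cvg_cst.
apply/ler_addgt0Pr => eps eps0.
have [k0 _ hk] := cvgr_lt _ dist0 _ eps0.
have {hk}hk : enorm (z (n + k0)%N - zbar) < eps.
  by apply: hk; rewrite /= leq_addl.
have -> : z n - zbar = (z n - z (n + k0)%N) + (z (n + k0)%N - zbar).
  by rewrite addrA subrK.
apply: le_trans (ler_enormD _ _) _.
have := tele k0; have := h0 _ (leq_trans Nn (leq_addr k0 n)); lra.
Qed.

(** * Descent lemma *)

(** The mean value theorem replaces the usual integral: subtracting from g (u + t h) its linear part
    and t^2 L / 2 |h|^2 leaves a function of t whose slope on (0, 1) is nonpositive, by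
    Cauchy-Schwarz and the Lipschitz bound. *)
Lemma descent (g : 'rV[R]_m -> R) (L : R) :
    (forall z, differentiable g z) ->
    (forall u v, enorm (gradient g u - gradient g v) <= L * enorm (u - v)) ->
  forall u h, g (u + h) <= g u + dotr (gradient g u) h + L / 2 * dotr h h.
Proof.
move=> gd gL u h.
(* A and B stand for the inner products of h with the gradients at u + c h and u, G for the norm of
   the difference of these gradients, N for the norm of h. *)
have slope_le0 (c A B N G : R) : A - B <= G * N -> G * N <= L * (c * N) * N ->
  A - B - 2 * c * (L / 2 * N ^+ 2) <= 0 by nra.
have endpoints (A B C D : R) :
    A - 1 * B - 1 ^+ 2 * C <= D - 0 * B - 0 ^+ 2 * C ->
  A <= D + B + C by lra.
pose f (t : R) := g (u + t *: h) - t * dotr (gradient g u) h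
  - t ^+ 2 * (L / 2 * dotr h h).
pose df (t : R) := dotr (gradient g (u + t *: h)) h - dotr (gradient g u) h
  - (2 * t) * (L / 2 * dotr h h).
have fder t : is_derive (t : R) (1 : R) f (df t).
  have gder : is_derive (t : R) (1 : R) (fun t : R => g (u + t *: h))
      (dotr (gradient g (u + t *: h)) h).
    have ldif : is_diff (t : R) (fun t : R => u + t *: h : 'rV[R]_m)
        (fun t : R => 0 + t *: h).
      exact: is_diffD.
    have ldiff : differentiable (fun t : R => u + t *: h : 'rV[R]_m) (t : R).
      exact: ex_diff.
    have gdif :
        differentiable (g \o (fun t : R => u + t *: h : 'rV[R]_m)) (t : R).
      by apply: differentiable_comp => //; exact: gd.
    apply: DeriveDef; first exact/derivable1_diffP.
    rewrite deriveE// diff_comp//.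
    by rewrite /= diff_val add0r scale1r diff_gradient.
  exact: is_derive_subquadratic.
have fcont : {within `[0, 1], continuous f}.
  apply: derivable_within_continuous => t _.
  by have [] := fder t.
have [c c01 fc] := MVT ltr01 (fun t _ => fder t) fcont.
have dfc : df c <= 0.
  move: c01; rewrite in_itv/= => /andP[c0 _].
  have := dotr_le_enorm (gradient g (u + c *: h) - gradient g u) h.
  have := gL (u + c *: h) u.
  have -> : u + c *: h - u = c *: h by apply/rowP => i; rewrite !mxE; ring.
  rewrite enormZ gtr0_norm// dotrDl dotrNl => gc dc.
  by rewrite /df -enorm_sqr; exact: slope_le0 dc (ler_wpM2r (enorm_ge0 h) gc).
have : f 1 <= f 0 by rewrite -subr_le0 fc subr0 mulr1.
rewrite /f scale1r scale0r addr0.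
exact: endpoints.
Qed.

End EuclideanNorm.

(** * Energy estimates for the inertial scheme *)

(** All vectors are expressed through a and w, which makes the claim an inequality between quadratic
    forms. Bounding q by [beta] gives coefficients that do not depend on the iteration. *)
Lemma inertial_energy_drop (R : realType) (m : nat) (L beta s q f f' : R)
    (x x' y y' G : 'rV[R]_m) :
    0 < s -> 0 <= q <= beta ->
    f' <= f + dotr G (y' - y) + L / 2 * dotr (y' - y) (y' - y) ->
    x' = y - s *: G -> y' = x' + q *: (x' - x) ->
  enorm ((x' - x) - (y' - y)) ^+ 2 / 2
    + (1 - s * L / 2 - beta) * enorm (y' - y) ^+ 2
  <= s * (f - f') + (enorm (y - x) ^+ 2 - enorm (y' - x') ^+ 2) / 2.
Proof.
move=> s0 /andP[q0 qb] + x'E y'E.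
set a := x' - x; set w := y' - y.
have ux : y - x = (1 + q) *: a - w.
  by rewrite /w y'E /a; apply/rowP => i; rewrite !mxE; ring.
have ux' : y' - x' = q *: a by rewrite y'E addrAC subrr add0r.
have gy : G = s^-1 *: (q *: a - w).
  apply: (scalerI (lt0r_neq0 s0)); rewrite scalerA divff ?gt_eqF// scale1r.
  have -> : s *: G = y - x' by rewrite x'E opprB addrCA subrr addr0.
  by rewrite /w y'E /a; apply/rowP => i; rewrite !mxE; ring.
rewrite gy ux ux' !enorm_sqr; clearbody a w; rewrite !dotrE (dotrC w a).
have := dotr_ge0 w; have := dotr_ge0 (a - w); rewrite !dotrE (dotrC w a).
set aa := dotr a a; set aw := dotr a w; set ww := dotr w w => aw0 w0 des.
have {}des : s * f' <= s * f + (q * aw - ww) + s * L / 2 * ww.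
  move: des; rewrite -(ler_pM2l s0); congr (_ <= _).
  by field; rewrite gt_eqF.
(* After [des], the slack is exactly q |a - w|^2 + (beta - q) |w|^2. *)
have h1 : 0 <= (beta - q) * ww by rewrite mulr_ge0// subr_ge0.
have h2 := mulr_ge0 q0 aw0.
lra.
Qed.

(** With a and w as before, y - x = q a + (a - w) and y - x' = q a - w, where |a| <= D and q <= 1.
    In the scheme y - x' is s times the gradient at y, so D controls the gradient too. *)
Lemma inertial_bounds (R : realType) (m : nat) (q : R) (x x' y y' : 'rV[R]_m) :
    0 <= q <= 1 -> y' = x' + q *: (x' - x) ->
  let D := enorm ((x' - x) - (y' - y)) + enorm (y' - y) in
  [/\ enorm (x' - x) <= D, enorm (y' - y) <= D, enorm (y - x) <= 2 * D
    & enorm (y - x') <= 2 * D].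
Proof.
move=> /andP[q0 q1] y'E D.
have le_qv (v : 'rV[R]_m) : enorm (q *: v) <= enorm v.
  by rewrite enormZ ger0_norm// ler_piMl// enorm_ge0.
have aD : enorm (x' - x) <= D.
  by apply: le_trans (ler_enormD _ _); rewrite subrK.
have wD : enorm (y' - y) <= D by rewrite lerDr enorm_ge0.
split=> //.
  have -> : y - x = q *: (x' - x) + ((x' - x) - (y' - y)).
    by rewrite y'E; apply/rowP => i; rewrite !mxE; ring.
  apply: le_trans (ler_enormD _ _) _.
  have := le_qv (x' - x); rewrite /D in aD wD *.
  by have := enorm_ge0 (y' - y); lra.
have -> : y - x' = q *: (x' - x) + - (y' - y).
  by rewrite y'E; apply/rowP => i; rewrite !mxE; ring.
apply: le_trans (ler_enormD _ _) _; rewrite enormN.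
by have := le_qv (x' - x); lra.
Qed.

(** Separates the two terms of the energy. The sum is at most twice the larger term and 2^theta <=
    2; for b <= 1 and theta >= 1/2, b^theta is at most the square root of b, which makes the
    quadratic term of the energy contribute linearly in |y_n - x_n|. *)
Lemma powR_addr_le (R : realType) (a b theta : R) :
    0 <= a -> 0 <= b <= 1 -> 2^-1 <= theta <= 1 ->
  (a + b) `^ theta <= 2 * (a `^ theta + Num.sqrt b).
Proof.
move=> a0 /andP[b0 b1] /andP[t2 t1].
have t0 : 0 <= theta by lra.
have bt : b `^ theta <= Num.sqrt b.
  rewrite -powR12_sqrt//; have [->|bN0] := eqVneq b 0.
    by rewrite !powR0// gt_eqF//; lra.
  by apply: ger_powR => //; rewrite b1 andbT lt_neqAle eq_sym bN0.
have two_t : 2 `^ theta <= (2 : R).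
  by apply: le_trans (ler_powR _ t1) _; rewrite ?powRr1//; lra.
have le2 c : 0 <= c -> (2 * c) `^ theta <= 2 * c `^ theta.
  by move=> c0; rewrite powRM// ler_wpM2r// powR_ge0.
have at0 := powR_ge0 a theta; have bs0 := sqrtr_ge0 b.
have [ab|/ltW ba] := leP a b.
  apply: (@le_trans _ _ ((2 * b) `^ theta)).
    by rewrite ge0_ler_powR ?nnegrE//; lra.
  by apply: le_trans (le2 _ b0) _; lra.
apply: (@le_trans _ _ ((2 * a) `^ theta)).
  by rewrite ge0_ler_powR ?nnegrE//; lra.
by apply: le_trans (le2 _ a0) _; lra.
Qed.

(** * Convergence rates *)

Theorem corollary16 (R : realType) (m : nat) (g : 'rV[R]_m -> R)
    (Lg alpha beta s theta : R) (x y : nat -> 'rV[R]_m) (xbar : 'rV[R]_m)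
    (g_diff : forall z : 'rV[R]_m, differentiable g z)
    (Lg_ge0 : 0 <= Lg)
    (g_lip : forall u v : 'rV[R]_m,
      enorm (gradient g u - gradient g v) <= Lg * enorm (u - v))
    (g_bnd : has_lbound (range g))
    (alpha_gt0 : 0 < alpha)
    (beta_gt0 : 0 < beta) (beta_lt1 : beta < 1)
    (s_gt0 : 0 < s) (s_lt : s * Lg < 2 * (1 - beta))
    (xy0 : x 0%N = y 0%N)
    (x_step : forall n : nat, x n.+1 = y n - s *: gradient g (y n))
    (y_step : forall n : nat, (1 <= n)%N ->
      y n = x n + (beta * n%:R / (n%:R + alpha)) *: (x n - x n.-1))
    (x_bnd : exists M : R, forall n : nat, enorm (x n) <= M)
    (xbar_crit : crit g xbar)
    (x_cvg : x n @[n --> \oo] --> xbar)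
    (theta_gt : 2^-1 < theta) (theta_lt1 : theta < 1)
    (g_loj : lojasiewicz_at g xbar theta) :
  exists b1 b2 b3 b4 : R, exists N1 : nat,
    [/\ 0 < b1, 0 < b2, 0 < b3 & 0 < b4] /\
    [/\ forall n : nat, (N1 + 2 <= n)%N ->
          g (y n) - g xbar <= b1 * (1 / n%:R `^ (1 / (2 * theta - 1))),
        forall n : nat, (N1 + 2 <= n)%N ->
          g (x n) - g xbar <= b2 * (1 / n%:R `^ (1 / (2 * theta - 1))),
        forall n : nat, (N1 + 2 <= n)%N ->
          enorm (x n - xbar)
            <= b3 * (1 / n%:R `^ ((1 - theta) / (2 * theta - 1))) &
        forall n : nat, (N1 + 2 < n)%N ->
          enorm (y n - xbar)
            <= b4 * (1 / n%:R `^ ((1 - theta) / (2 * theta - 1)))].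
Proof.
have [K [eps [K0 eps0 gK]]] := g_loj.
have gdesc := descent g_diff g_lip.
(* This is the inertial coefficient of index n + 1, shifted so that [yE] holds for every n. *)
pose q n : R := beta * n.+1%:R / (n.+1%:R + alpha).
have q_ge0 n : 0 <= q n by rewrite !mulr_ge0 ?invr_ge0 ?addr_ge0// ltW.
have q_le n : q n <= beta.
  have n0 : 0 < n.+1%:R :> R by rewrite ltr0n.
  by rewrite ler_pdivrMr ?addr_gt0// ler_pM2l// lerDl ltW.
have yE n : y n.+1 = x n.+1 + q n *: (x n.+1 - x n) by rewrite y_step.
pose E n := g (y n) + enorm (y n - x n) ^+ 2 / (2 * s).
pose e n := E n - g xbar.
pose D n := enorm ((x n.+1 - x n) - (y n.+1 - y n)) + enorm (y n.+1 - y n).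
(* The smaller of the two coefficients in [inertial_energy_drop], positive by [s_lt]. In [c], the 2
   comes from D^2 <= 2 (|a - w|^2 + |w|^2) and s from the scaling of the energy. *)
pose k := Num.min 2^-1 (1 - s * Lg / 2 - beta).
have k0 : 0 < k by rewrite lt_min; apply/andP; split; lra.
pose c := k / (2 * s).
have c0 : 0 < c by rewrite divr_gt0// mulr_gt0.
have D0 n : 0 <= D n by rewrite addr_ge0 ?enorm_ge0.
have drop n : c * D n ^+ 2 <= e n - e n.+1.
  have := gdesc (y n) (y n.+1 - y n); rewrite subrKC => gd.
  have q01 : 0 <= q n <= beta by rewrite q_ge0 q_le.
  have := inertial_energy_drop s_gt0 q01 gd (x_step n) (yE n).
  rewrite -(ler_pM2l s_gt0).
  have -> : s * (c * D n ^+ 2) = k * D n ^+ 2 / 2.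
    by rewrite /c; field; rewrite gt_eqF.
  have -> : s * (e n - e n.+1) = s * (g (y n) - g (y n.+1))
      + (enorm (y n - x n) ^+ 2 - enorm (y n.+1 - x n.+1) ^+ 2) / 2.
    by rewrite /e /E; field; rewrite gt_eqF.
  apply: le_trans; rewrite /D.
  have k1 : k <= 2^-1 by rewrite ge_min lexx.
  have k2 : k <= 1 - s * Lg / 2 - beta by rewrite ge_min lexx orbT.
  move: (enorm _) (enorm _) => a w.
  have := ler_wpM2r (sqr_ge0 a) k1; have := ler_wpM2r (sqr_ge0 w) k2.
  have := mulr_ge0 (ltW k0) (sqr_ge0 (a - w)); nra.
have bnd n := @inertial_bounds R m (q n) (x n) (x n.+1) (y n) (y n.+1).
have {}bnd n : [/\ enorm (x n.+1 - x n) <= D n, enorm (y n.+1 - y n) <= D n,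
    enorm (y n - x n) <= 2 * D n & enorm (y n - x n.+1) <= 2 * D n].
  apply: bnd => //; rewrite q_ge0 (le_trans (q_le n))//; exact: ltW.
have gradD n : enorm (gradient g (y n)) <= 2 * D n / s.
  have [_ _ _] := bnd n; rewrite x_step opprB addrCA subrr addr0 enormZ.
  by rewrite gtr0_norm// ler_pdivlMr// mulrC.
have u_cvg : y n - x n @[n --> \oo] --> (0 : 'rV[R]_m).
  have d_cvg : `|x n.+1 - x n| @[n --> \oo] --> (0 : R).
    rewrite -(@normr0 _ 'rV[R]_m); apply: cvg_norm; rewrite -(subrr xbar).
    by apply: cvgB => //; rewrite (cvg_shiftS x).
  rewrite -(cvg_shiftS (fun n => y n - x n)); apply/norm_cvg0P.
  apply: squeeze_cvgr d_cvg; last exact: cvg_cst.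
  apply: nearW => n; rewrite normr_ge0 /= yE addrAC subrr add0r normrZ.
  by rewrite ger0_norm// ler_piMl// (le_trans (q_le n)) ?ltW.
have y_cvg : y n @[n --> \oo] --> xbar.
  have -> : y = (fun n => (y n - x n) + x n).
    by apply/funext => n; rewrite subrK.
  by rewrite -[X in _ --> X]add0r; exact: cvgD.
have v_cvg : enorm (y n - x n) ^+ 2 / (2 * s) @[n --> \oo] --> (0 : R).
  rewrite -(mul0r (2 * s)^-1); apply: cvgM; last exact: cvg_cst.
  rewrite -[X in _ --> X](mulr0 0).
  exact: cvgM (enorm_cvg0 u_cvg) (enorm_cvg0 u_cvg).
have e_cvg : e n @[n --> \oo] --> (0 : R).
  rewrite -(subrr (g xbar)); apply: cvgB; last exact: cvg_cst.
  rewrite -[X in _ --> X]addr0; apply: cvgD => //.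
  apply: (cvg_comp _ _ y_cvg); exact: differentiable_continuous (g_diff xbar).
have e_dec n : e n.+1 <= e n.
  by rewrite -subr_ge0 (le_trans _ (drop n))// mulr_ge0 ?sqr_ge0// ltW.
(* A nonincreasing sequence stays above its limit, here 0. *)
have e0 n : 0 <= e n.
  have <- : limn e = 0 by apply/cvg_lim.
  apply: nonincreasing_cvgn_ge; first exact/nonincreasing_seqP.
  by apply/cvg_ex; exists 0.
(* The outer 2 is that of [powR_addr_le]; the first summand comes from the Lojasiewicz inequality
   with [gradD], the second from |y_n - x_n| <= 2 D_n. *)
pose C := 2 * (K * (2 / s) + 2 / Num.sqrt (2 * s)).
have C0 : 0 < C.
  by rewrite mulr_gt0// addr_gt0 ?mulr_gt0 ?invr_gt0 ?sqrtr_gt0 ?mulr_gt0.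
(* From N on, y_n lies in the Lojasiewicz ball and the quadratic term of the energy is at most 1. *)
have [N eC] : exists N, forall n, (N <= n)%N -> e n `^ theta <= C * D n.
  have y0 : enorm (y n - xbar) @[n --> \oo] --> (0 : R).
    by apply: enorm_cvg0; rewrite -(subrr xbar); apply: cvgB => //;
    exact: cvg_cst.
  have [N1 _ hN1] := cvgr_lt _ y0 _ eps0.
  have [N2 _ hN2] := cvgr_lt _ v_cvg _ ltr01.
  exists (maxn N1 N2) => n; rewrite geq_max => /andP[n1 n2].
  have := gK _ (hN1 _ n1); have /ltW := hN2 _ n2.
  set v := _ / _ => v1 gn.
  have v0 : 0 <= v by rewrite mulr_ge0 ?sqr_ge0// invr_ge0 mulr_ge0// ltW.
  apply: (@le_trans _ _ ((`|g (y n) - g xbar| + v) `^ theta)).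
    rewrite ge0_ler_powR ?nnegrE ?e0 ?(addr_ge0 (normr_ge0 _) v0)//; first lra.
    by rewrite /e /E addrAC lerD2r ler_norm.
  have v01 : 0 <= v <= 1 by rewrite v0.
  have th1 : 2^-1 <= theta <= 1 by rewrite !ltW.
  apply: le_trans (powR_addr_le (normr_ge0 _) v01 th1) _.
  rewrite -mulrA ler_pM2l// mulrDl lerD//.
    apply: le_trans gn _; rewrite -mulrA ler_pM2l//.
    by apply: le_trans (gradD n) _; rewrite mulrAC.
  rewrite /v sqrtrM ?sqr_ge0// sqrtr_sqr ger0_norm ?enorm_ge0//.
  rewrite sqrtrV ?mulr_ge0 ?(ltW s_gt0)//.
  by rewrite [leRHS]mulrAC ler_wpM2r ?invr_ge0 ?sqrtr_ge0//; have [] := bnd n.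
have eM n : (N <= n)%N -> e n `^ (2 * theta) <= C ^+ 2 / c * (e n - e n.+1).
  move=> Nn; rewrite mulrC powRrM -[2]/(2%:R) powR_mulrn ?powR_ge0//.
  rewrite -mulrA (le_trans _ (ler_wpM2l (sqr_ge0 C) (_ : D n ^+ 2 <= _)))//.
    by rewrite -exprMn ler_sqr ?nnegrE ?powR_ge0 ?eC// mulr_ge0// ltW.
  by rewrite mulrC ler_pdivlMr// mulrC.
have M0 : 0 < C ^+ 2 / c by rewrite divr_gt0// exprn_gt0.
have [b b0 eb] := loj_rate theta_gt M0 (fun n _ => e0 n) eM.
pose A := 2 * C / ((1 - theta) * c).
have A0 : 0 < A.
  by apply: divr_gt0; apply: mulr_gt0; rewrite // subr_gt0.
pose h n := A * e n `^ (1 - theta).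
have h0 n : (N <= n)%N -> 0 <= h n by rewrite mulr_ge0 ?powR_ge0// ltW.
have Dh n : (N <= n)%N -> D n <= h n - h n.+1.
  move=> Nn; rewrite -mulrBr; apply: loj_increment (drop n) (eC _ Nn) => //.
  by apply/andP; split; lra.
have hb n : (N < n)%N -> h n <= A * b `^ (1 - theta)
    * (1 / n%:R `^ ((1 - theta) / (2 * theta - 1))).
  move=> Nn; rewrite -mulrA ler_pM2l// div1r -powRN.
  have -> : - ((1 - theta) / (2 * theta - 1)) =
      - (1 / (2 * theta - 1)) * (1 - theta).
    by field; rewrite gt_eqF//; lra.
  rewrite powRrM -powRM ?powR_ge0 ?(ltW b0)//.
  by rewrite ge0_ler_powR ?nnegrE ?mulr_ge0 ?powR_ge0 ?eb ?(ltW b0)//; lra.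
have eb' n : (N < n)%N -> e n <= b * (1 / n%:R `^ (1 / (2 * theta - 1))).
  by move=> Nn; rewrite [1 / _ `^ _]div1r -powRN eb.
pose b' := A * b `^ (1 - theta).
have b'0 : 0 < b' by rewrite mulr_gt0 ?powR_gt0.
(* The descent lemma from y_n to x_n costs at most (2 D / s) (2 D) + (Lg / 2) (2 D)^2 = (4 / s + 2
   Lg) D^2, while c D^2 <= e_n because e_(n+1) >= 0. *)
pose r := 1 + (4 / s + 2 * Lg) / c.
have r0 : 0 < r by rewrite addr_gt0// divr_gt0// ltr_wpDr ?mulr_ge0// divr_gt0.
have gx n : g (x n) - g xbar <= r * e n.
  have := gdesc (y n) (x n - y n); rewrite subrKC -enorm_sqr => gd.
  have [_ _ uD _] := bnd n.
  have dE : enorm (x n - y n) = enorm (y n - x n) by rewrite -opprB enormN.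
  have cs := dotr_le_enorm (gradient g (y n)) (x n - y n).
  have cs' := ler_pM (enorm_ge0 _) (enorm_ge0 _) (gradD n) uD.
  have u2 : Lg / 2 * enorm (y n - x n) ^+ 2 <= Lg / 2 * (2 * D n) ^+ 2.
    by rewrite ler_wpM2l ?divr_ge0// ler_sqr ?nnegrE ?enorm_ge0 ?mulr_ge0.
  have ge : g (y n) - g xbar <= e n.
    by rewrite lerD2r lerDl mulr_ge0 ?sqr_ge0// invr_ge0 mulr_ge0// ltW.
  have De : (4 / s + 2 * Lg) * D n ^+ 2 <= (4 / s + 2 * Lg) / c * e n.
    rewrite -mulrA ler_wpM2l ?addr_ge0 ?mulr_ge0 ?invr_ge0 ?(ltW s_gt0)//.
    rewrite mulrC ler_pdivlMr// mulrC (le_trans (drop n))//.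
    by rewrite gerBl.
  rewrite dE in gd cs.
  rewrite /r mulrDl mul1r.
  have expand : 2 * D n / s * (2 * D n) + Lg / 2 * (2 * D n) ^+ 2
    = (4 / s + 2 * Lg) * D n ^+ 2 by field; rewrite gt_eqF.
  clear -gd cs cs' u2 ge De expand; lra.
(* The steps of x and of y are both bounded by D, hence by the same differences of h, so one
   constant serves both distances. *)
exists b, (r * b), b', b', N; split; first by split=> //; rewrite mulr_gt0.
have ltN n : (N + 2 <= n)%N -> (N < n)%N.
  by apply: leq_trans; rewrite addn2.
split=> n Nn.
- apply: le_trans (eb' _ (ltN _ Nn)).
  by rewrite lerD2r lerDl divr_ge0 ?sqr_ge0// mulr_ge0// ltW.
- apply: le_trans (gx n) _; rewrite -mulrA ler_pM2l//; exact: eb' (ltN _ Nn).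
- apply: (le_trans _ (hb _ (ltN _ Nn))).
  apply: enorm_lim_le x_cvg h0 _ _ (ltnW (ltN _ Nn)) => i Ni.
  by apply: le_trans (Dh _ Ni); have [] := bnd i.
- apply: (le_trans _ (hb _ (ltN _ (ltnW Nn)))).
  apply: enorm_lim_le y_cvg h0 _ _ (ltnW (ltN _ (ltnW Nn))) => i Ni.
  by apply: le_trans (Dh _ Ni); have [] := bnd i.
Qed.
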